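(* Let $k$ be an odd positive integer. Then the set $\mathscr{C}(k)=\{S\mid S\text{ is a Coe-semigroup and }k\in S\}$ is nonempty and finite.
   Context: $\mathbb{N}=\{0,1,2,\ldots\}$. A numerical semigroup is a subset of $\mathbb{N}$ containing $0$, closed under addition and with finite complement in $\mathbb{N}$. A numerical semigroup $S$ is a Coe-semigroup if $\{x-1,x+1\}\subseteq S$ for every odd $x\in S$. *)

(* Defs.v *)
From mathcomp Require Import all_boot.
From mathcomp Require Import boolp classical_sets functions cardinality.

Set Implicit Arguments.
Unset Strict Implicit.
Unset Printing Implicit Defensive.

Local Open Scope classical_set_scope.

Record numerical_semigroup (S : set nat) : Prop := NumericalSemigroup {
  numerical_semigroup0 : S 0;
  numerical_semigroupD : forall x y, S x -> S y -> S (x + y);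
  numerical_semigroup_cofinite : cofinite_set S
}.

(* An odd x is positive, so the truncated predecessor x.-1 is x - 1. *)
Definition coe_semigroup (S : set nat) : Prop :=
  numerical_semigroup S /\
  forall x, odd x -> S x -> [set x.-1; x.+1] `<=` S.

Definition coe_semigroups_with (k : nat) : set (set nat) :=
  [set S | coe_semigroup S /\ S k].

(* Main.v *)
(* A Coe-semigroup containing the odd number k also contains k + 1, hence every
   n >= k ^ 2: if n = q k + r with r < k <= q, then n = (q - r) k + r (k + 1).
   So it is determined by its elements below k ^ 2. *)
Require Import Defs.
From mathcomp Require Import all_boot.
From mathcomp Require Import boolp classical_sets functions cardinality.

Local Open Scope classical_set_scope.

Lemma numerical_semigroupM (S : set nat) (a x : nat) :
  numerical_semigroup S -> S x -> S (a * x).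
Proof.
move=> [S0 SD _] Sx; elim: a => [|a IHa]; first by rewrite mul0n.
by rewrite mulSn; apply: SD.
Qed.

Lemma numerical_semigroup_consecutive (S : set nat) (k n : nat) :
  numerical_semigroup S -> S k -> S k.+1 -> 0 < k -> k * k <= n -> S n.
Proof.
move=> nS Sk Sk1 k_gt0 le_kk_n.
have le_r_q : n %% k <= n %/ k.
  by rewrite (leq_trans (ltnW (ltn_pmod n k_gt0))) // leq_divRL.
have -> : n = (n %/ k - n %% k) * k + n %% k * k.+1.
  by rewrite mulnS addnCA -mulnDl subnK // addnC -divn_eq.
by case: (nS) => _ SD _; apply: SD; apply: numerical_semigroupM.
Qed.

(** Such a set is determined by its trace on ['I_N], which has only finitely many subsets. *)
Lemma finite_sets_containing_tail (N : nat) :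
  finite_set [set S : set nat | forall n, N <= n -> S n].
Proof.
(* Every [n >= N] lies in [F A] vacuously, as no [i : 'I_N] equals it; so [F A] is [A] together with
   the whole tail. *)
pose F (A : {set 'I_N}) : set nat := [set n | forall i : 'I_N, i = n :> nat -> i \in A].
apply: (@sub_finite_set _ _ (F @` setT)); last first.
  exact/finite_image/finite_finset.
move=> S tailS; exists [set i : 'I_N | `[< S i >]]%SET => //.
apply/seteqP; split=> n /=.
  move=> FSn; case: (ltnP n N) => [lt_nN | /tailS //].
  by have := FSn (Ordinal lt_nN) erefl; rewrite inE => /asboolP.
by move=> Sn i eq_in; rewrite inE eq_in; apply/asboolP.
Qed.

Theorem proposition18 (k : nat) (k_odd : odd k) (k_gt0 : 0 < k) :
  coe_semigroups_with k !=set0 /\ finite_set (coe_semigroups_with k).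
Proof.
split.
  by exists setT; split=> //; split=> //; split.
apply: sub_finite_set (finite_sets_containing_tail (k * k)).
move=> S [[nS coeS] Sk] n; apply: numerical_semigroup_consecutive => //.
(* The one premise left is [S k.+1], which the Coe condition at the odd element [k] supplies. *)
by apply: (coeS k) => //; right.
Qed.
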